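(* Let $J$ be the symmetric Jacobi matrix corresponding to a positive-definite linear functional $\mathcal{L}$ normalized by $\mathcal{L}(1)=1$. Let $\kappa\in\mathbb{C}_\pm$ and let $s_0^*=\mathcal{L}^{-*}(1)\in\overline{\mathbb{C}}_\mp\setminus(\{0\}\cup\{m(J;\kappa)\})$. If $J$ is a bounded operator on $\ell^2$, then $$\sigma(J_G(\kappa))=\sigma(J)\cup\{\kappa\},$$ where $J_G(\kappa)$ is the (symmetrized) Geronimus transformation of $J$ at $\kappa$ with parameter $s_0^*$ and $\sigma$ denotes the spectrum of the operator on $\ell^2$.
   Context: $\mathbb{C}_\pm=\{z:\pm\operatorname{Im}z>0\}$ and $\overline{\mathbb{C}}_\mp=\{z\in\mathbb{C}:\mp\operatorname{Im}z\ge0\}$ (upper signs together or lower signs together). A linear functional $\mathcal{L}:\mathbb{C}[z]\to\mathbb{C}$ is positive-definite if $\mathcal{L}[p]>0$ for every polynomial $p$ that is not identically zero and is non-negative on $\mathbb{R}$. Its monic orthogonal polynomials $P_n$ ($\deg P_n=n$, $\mathcal{L}[P_nP_m]=0$ for $n\neq m$) satisfy $P_0=1$, $P_1(z)=z-c_1$, $zP_n=P_{n+1}+c_{n+1}P_n+\lambda_{n+1}P_{n-1}$ for $n\ge1$, with $c_n\in\mathbb{R}$, $\lambda_n>0$. The symmetric Jacobi matrix $J$ corresponding to $\mathcal{L}$ is the semi-infinite symmetric tridiagonal matrix with diagonal $b_j=c_{j+1}$ and off-diagonal entries $a_j=\sqrt{\lambda_{j+2}}$, $j\ge0$. It generates a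 closed operator on $\ell^2$. Its $m$-function is $m(J;z)=((J-zI)^{-1}e_0,e_0)_{\ell^2}$ for $z$ in the resolvent set, $e_0=(1,0,0,\dots)^\top$. A Geronimus transformation of $\mathcal{L}$ at $\kappa$ is the functional $\mathcal{L}^{-*}$ with $\mathcal{L}^{-*}((z-\kappa)p(z))=\mathcal{L}(p(z))$ for all polynomials $p$ and $\mathcal{L}^{-*}(1)=s_0^*$ (a free parameter). Let $Q_n(z)=\mathcal{L}\left(\frac{P_n(z)-P_n(y)}{z-y}\right)_y$ and $R_n(z)=P_n(z)+\frac{1}{s_0^*}Q_n(z)$; for $\kappa\in\mathbb{C}_\pm$ and $s_0^*\in\overline{\mathbb{C}}_\mp\setminus\{0\}$ one has $R_n(\kappa)\neq0$ for all $n\ge0$. Put $t_0=1$, $u_0^2=1/s_0^*$, and for $j\ge1$, $t_j=-R_j(\kappa)/R_{j-1}(\kappa)$, $u_j=a_{j-1}/t_j$. Let $U$ be the upper bidiagonal semi-infinite matrix with diagonal entries $u_0\sqrt{t_0},u_1\sqrt{t_1},\dots$ and superdiagonal entries $\sqrt{t_1},\sqrt{t_2},\dots$ (either value of each complex square root may be taken). Then $J-\kappa I=UU^\top$ ($\top$ is the transpose without complex conjugation) and $J_G(\kappa)=U^\top U+\kappa I$. *)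

(* Defs.v *)
From HB Require Import structures.
From mathcomp Require Export all_boot all_order all_algebra.
From mathcomp Require Export complex.
From mathcomp Require Export all_classical all_reals all_analysis.
Export Order.TTheory GRing.Theory Num.Theory.
Export numFieldNormedType.Exports.

Set Implicit Arguments.
Unset Strict Implicit.
Unset Printing Implicit Defensive.

Local Open Scope classical_set_scope.
Local Open Scope ring_scope.
Local Open Scope complex_scope.

Section Functionals.
Variable R : realType.
Local Notation C := (R[i]).

(* In the order of R[i], 0 <= z and 0 < z entail that z is real. *)
Definition positive_definite (L : {scalar {poly C}}) : Prop :=
  forall p : {poly C}, p != 0 -> (forall x : R, 0 <= p.[x%:C]) -> 0 < L p.

Definition monic_orthogonal (L : {scalar {poly C}}) (P : nat -> {poly C}) : Prop :=
  [/\ forall n, P n \is monic,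
      forall n, size (P n) = n.+1
    & forall n m, n <> m -> L (P n * P m) = 0].

(* The values c 0, lam 0 and lam 1 are not used. *)
Definition three_term_recurrence (P : nat -> {poly C}) (c lam : nat -> R) : Prop :=
  [/\ P 0%N = 1,
      P 1%N = 'X - (c 1%N)%:C%:P
    & forall n, (1 <= n)%N ->
        'X * P n = P n.+1 + (c n.+1)%:C *: P n + (lam n.+1)%:C *: P n.-1].

Definition geronimus_functional (L : {scalar {poly C}}) (kappa : C)
    (Lg : {scalar {poly C}}) : Prop :=
  forall p : {poly C}, Lg (('X - kappa%:P) * p) = L p.

(* For fixed z, the quotient below is, as a polynomial in the variable 'X = y,
   (P_n(z) - P_n(y)) / (z - y); the division is exact. *)
Definition second_kind (L : {scalar {poly C}}) (P : nat -> {poly C})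
    (n : nat) (z : C) : C :=
  L (((P n).[z]%:P - P n) %/ (z%:P - 'X)).

Definition geronimus_R (L : {scalar {poly C}}) (P : nat -> {poly C}) (s0 : C)
    (n : nat) (z : C) : C :=
  (P n).[z] + s0^-1 * second_kind L P n z.

End Functionals.

Section InfiniteMatrices.
Variable R : realType.
Local Notation C := (R[i]).

(* Semi-infinite matrices.  The sums below range over all of nat; they are the
   finitely supported sums of fsbigop, hence exact on banded matrices. *)
Definition infmx := nat -> nat -> C.

Definition infmx_tr (A : infmx) : infmx := fun i j => A j i.

Definition infmx_mul (A B : infmx) : infmx :=
  fun i k => \sum_(j \in [set: nat]) (A i j * B j k).

Definition infmx_add (A B : infmx) : infmx := fun i j => A i j + B i j.

Definition infmx_scalar (z : C) : infmx := fun i j => if i == j then z else 0.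

Definition infmx_act (A : infmx) (x : nat -> C) : nat -> C :=
  fun i => \sum_(j \in [set: nat]) (A i j * x j).

Definition jacobi_b (c : nat -> R) (j : nat) : C := (c j.+1)%:C.
Definition jacobi_a (lam : nat -> R) (j : nat) : C := (Num.sqrt (lam j.+2))%:C.

Definition jacobi_mx (c lam : nat -> R) : infmx := fun i j =>
  if i == j then jacobi_b c i
  else if j == i.+1 then jacobi_a lam i
  else if i == j.+1 then jacobi_a lam j
  else 0.

Definition geronimus_t (L : {scalar {poly C}}) (P : nat -> {poly C})
    (kappa s0 : C) (j : nat) : C :=
  if j is k.+1 then - (geronimus_R L P s0 k.+1 kappa / geronimus_R L P s0 k kappa)
  else 1.

(* u0 is a chosen square root of 1 / s0. *)
Definition geronimus_u (L : {scalar {poly C}}) (P : nat -> {poly C})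
    (lam : nat -> R) (kappa s0 u0 : C) (j : nat) : C :=
  if j is k.+1 then jacobi_a lam k / geronimus_t L P kappa s0 k.+1 else u0.

(* rt j is a chosen square root of t_j. *)
Definition bidiagonal_mx (u rt : nat -> C) : infmx := fun i j =>
  if i == j then u i * rt i
  else if j == i.+1 then rt j
  else 0.

(* J_G(kappa), for the choices u0 and rt of the square roots. *)
Definition geronimus_mx (L : {scalar {poly C}}) (P : nat -> {poly C})
    (lam : nat -> R) (kappa s0 u0 : C) (rt : nat -> C) : infmx :=
  let U := bidiagonal_mx (geronimus_u L P lam kappa s0 u0) rt in
  infmx_add (infmx_mul (infmx_tr U) U) (infmx_scalar kappa).

End InfiniteMatrices.

Section Operators.
Variable R : realType.
Local Notation C := (R[i]).
Local Notation seqC := (nat -> C).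

Definition l2norm (x : seqC) : \bar R :=
  Lnorm counting 2%:E (fun n => (complex.Re `|x n|)%:E).

Definition l2 : set seqC := [set x | (l2norm x < +oo)%E].

(* Linear in the first argument. *)
Definition l2inner (x y : seqC) : C :=
  limn (fun n : nat => (\sum_(k < n) x k * (y k)^*) : C^o).

Definition e0 : seqC := fun n => if n == 0%N then 1 else 0.

Definition finitely_supported (x : seqC) : Prop :=
  exists N, forall n, (N <= n)%N -> x n = 0.

(* Operators in l2 are represented by their graphs: T x y means that x is in
   the domain of T and T maps x to y. *)
Definition operator := seqC -> seqC -> Prop.

(* The closed operator generated by a matrix: the closure, in l2 x l2, of its
   action on finitely supported sequences. *)
Definition matrix_operator (A : infmx R) : operator := fun x y =>
  [/\ l2 x, l2 y &
      forall eps : R, 0 < eps ->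
        exists v, [/\ finitely_supported v,
          (l2norm (v \- x)%R < eps%:E)%E & (l2norm (infmx_act A v \- y)%R < eps%:E)%E]].

Definition bounded_operator (T : operator) : Prop :=
  (forall x, l2 x -> exists y, T x y) /\
  exists M : R, forall x y, T x y -> (l2norm y <= M%:E * l2norm x)%E.

(* B is, on l2, a bounded everywhere defined inverse of T - z. *)
Definition is_resolvent (T : operator) (z : C) (B : seqC -> seqC) : Prop :=
  [/\ forall y, l2 y -> T (B y) (y \+ z \*o B y),
      forall x y, T x y -> B (y \- z \*o x) = x
    & exists M : R, forall y, l2 y -> (l2norm (B y) <= M%:E * l2norm y)%E].

Definition resolvent_set (T : operator) : set C :=
  [set z | exists B, is_resolvent T z B].

Definition spectrum (T : operator) : set C := ~` resolvent_set T.

(* Meaningful for z in the resolvent set only. *)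
Definition resolvent (T : operator) (z : C) : seqC -> seqC :=
  xget (fun=> fun=> 0) [set B | is_resolvent T z B].

Definition m_function (T : operator) (z : C) : C :=
  l2inner (resolvent T z e0) e0.

End Operators.
Arguments e0 {R}.

(* Main.v *)
Require Import Defs.
From mathcomp Require Import ring lra zify.

Set Implicit Arguments.
Unset Strict Implicit.
Unset Printing Implicit Defensive.

Local Open Scope classical_set_scope.
Local Open Scope ring_scope.
Local Open Scope complex_scope.

Import Normc.

(* Since [Im t_j] keeps the sign opposite to [Im kappa], [|t_j| >= |Im kappa|], so
   [U] is bounded.  Hence [J - kappa = U U^T] and [J_G - kappa = U^T U] have the
   same spectrum away from [0].  The non-real [kappa] is regular for the
   self-adjoint [J]: the map [1 - i tau (J - kappa)] is a strict contraction of l2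
   for a suitable real [tau].  If [kappa] were regular for [J_G] too, then
   [U^T x = e0] would have a solution in l2, and [U e0 = u0 rt_0 e0] would give
   [m (J; kappa) = s0]. *)

(** The transpose carries no conjugation, so [U^T] is not the adjoint of [U] and the spectra of
    [U U^T] and [U^T U] are compared by pure algebra on resolvents. The formula divides by
    [z - kappa]; hence [kappa] is treated by hand on both sides, and its regularity for [J] is also
    what gives [m (J; kappa)] a meaning. The square roots in [U] are arbitrary choices, so only the
    squares of its entries, [t_j] and [lam_(j+1) / t_j], can be estimated. The lower bound on
    [|t_j|] controls the second kind, and the recurrence [t_(j+1) = c_(j+1) - kappa - lam_(j+1) /
    t_j] then bounds [t_(j+1)] from above. The half-plane condition on [s0] starts the induction: in
    [t_1 = c_1 - kappa - 1 / s0] the term [1 / s0] takes the place of [lam / t]. Operators are given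
    as closures of graphs. Boundedness of [J] is first reduced to a bound on its entries; once [U]
    is bounded, [J] and [J_G] become everywhere defined maps of l2 and the graphs disappear from the
    argument. *)

Section ComplexModulus.
Variable R : realType.
Local Notation C := (R[i]).

Lemma Re_norm (z : C) : complex.Re `|z| = normc z.
Proof. by case: z => a b; rewrite normc_def. Qed.

Lemma normc_ge0 (z : C) : 0 <= normc z.
Proof. by case: z => a b; rewrite sqrtr_ge0. Qed.

Lemma sqr_normc (z : C) : normc z ^+ 2 = complex.Re z ^+ 2 + complex.Im z ^+ 2.
Proof. by case: z => a b; rewrite sqr_sqrtr ?addr_ge0 ?sqr_ge0. Qed.

Lemma normcB (x y : C) : normc (x - y) <= normc x + normc y.
Proof. by rewrite -(normcN y) le_normcD. Qed.

Lemma normc_real (x : R) : normc x%:C = `|x|.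
Proof. by rewrite /= expr0n /= addr0 sqrtr_sqr. Qed.

Lemma normc_le_eps (z : C) (K : R) :
  (forall e : R, 0 < e -> normc z <= K * e) -> z = 0.
Proof.
move=> h; apply/eq0_normc/eqP; rewrite eq_le normc_ge0 andbT.
apply/ler_addgt0Pl => e e0; rewrite addr0.
have K0 : 0 < `|K| + 1 by rewrite ltr_wpDl.
apply: (le_trans (h (e / (`|K| + 1)) (divr_gt0 e0 K0))).
rewrite mulrCA ger_pMr// ler_pdivrMr// mul1r.
by rewrite (le_trans (ler_norm K))// lerDl.
Qed.

Lemma Re_le_normc (z : C) : `|complex.Re z| <= normc z.
Proof.
rewrite -(ler_pXn2r (_ : 0 < 2)%N) ?nnegrE ?normc_ge0//.
by rewrite sqr_normc real_normK ?num_real// lerDl sqr_ge0.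
Qed.

Lemma Im_le_normc (z : C) : `|complex.Im z| <= normc z.
Proof.
rewrite -(ler_pXn2r (_ : 0 < 2)%N) ?nnegrE ?normc_ge0//.
by rewrite sqr_normc real_normK ?num_real// lerDr sqr_ge0.
Qed.

Lemma ReD (x y : C) : complex.Re (x + y) = complex.Re x + complex.Re y.
Proof. by case: x y => [a b] [c d]. Qed.
Lemma ImD (x y : C) : complex.Im (x + y) = complex.Im x + complex.Im y.
Proof. by case: x y => [a b] [c d]. Qed.
Lemma ReN (x : C) : complex.Re (- x) = - complex.Re x.
Proof. by case: x. Qed.
Lemma ImN (x : C) : complex.Im (- x) = - complex.Im x.
Proof. by case: x. Qed.
Lemma ReM (x y : C) : complex.Re (x * y) =
  complex.Re x * complex.Re y - complex.Im x * complex.Im y.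
Proof. by case: x y => [a b] [c d]. Qed.
Lemma ImM (x y : C) : complex.Im (x * y) =
  complex.Re x * complex.Im y + complex.Im x * complex.Re y.
Proof. by case: x y => [a b] [c d]. Qed.
Definition ReImE := (ReD, ImD, ReN, ImN, ReM, ImM).

End ComplexModulus.

Arguments normc : simpl never.

(** * Norm bounds in l2 through finite partial sums *)

Section L2.
Variable R : realType.
Local Notation C := (R[i]).
Local Notation seqC := (nat -> C).
Implicit Types (x y : seqC) (M K : R).

(** Bounding the norm by a real through finite sums keeps all estimates in [R]. The sign condition
    matters because [M] otherwise enters only through its square. *)
Definition l2_le x M :=
  0 <= M /\ forall n, \sum_(k < n) normc (x k) ^+ 2 <= M ^+ 2.

(** The bridge to the extended-real norm: the exponent [1/2] is removed by monotonicity of powers,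
    and a series of nonnegative terms is bounded exactly when its partial sums are. *)
Lemma l2norm_leP x M : 0 <= M -> (l2norm x <= M%:E)%E <-> l2_le x M.
Proof.
move=> M0; rewrite /l2norm Lnorm_counting//.
have -> : (\sum_(0 <= k <oo) `|(complex.Re `|x k|)%:E| `^ 2 =
           \sum_(0 <= k <oo) (normc (x k) ^+ 2)%:E)%E.
  apply: eq_eseriesr => k _; rewrite Re_norm /= ger0_norm ?normc_ge0//.
  by rewrite powR_mulrn ?normc_ge0.
set S := (X in (X `^ _)%E).
have S0 : (0 <= S)%E by apply: nneseries_ge0 => k _ _; rewrite lee_fin sqr_ge0.
have -> : (S `^ 2^-1 <= M%:E)%E = (S <= (M ^+ 2)%:E)%E.
  apply/idP/idP => h.
    have := @gt0_ler_poweR _ 2 _ _ _ _ _ h.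
    rewrite -poweRrM mulVf// poweRe1// poweR_EFin powR_mulrn//; apply=> //.
      by rewrite in_itv /= poweR_ge0 leey.
    by rewrite in_itv /= lee_fin M0 leey.
  have := @gt0_ler_poweR _ 2^-1 _ _ _ _ _ h.
  rewrite poweR_EFin -powR_mulrn// -powRrM divff// powRr1//; apply=> //.
    by rewrite in_itv /= S0 leey.
  by rewrite in_itv /= lee_fin ?powR_ge0 ?sqr_ge0 leey.
split=> [h|[_ h]].
  split=> // n; rewrite -lee_fin; apply: le_trans h.
  rewrite -sumEFin -(big_mkord xpredT (fun k => (normc (x k) ^+ 2)%:E)).
  by apply: nneseries_lim_ge => k _ _; rewrite lee_fin sqr_ge0.
apply: lime_le; first by apply: is_cvg_nneseries => k _ _; rewrite lee_fin sqr_ge0.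
by apply: nearW => n; rewrite big_mkord sumEFin lee_fin.
Qed.

Lemma l2P x : l2 x <-> exists M, l2_le x M.
Proof.
have x0 : (0 <= l2norm x)%E by exact: Lnorm_ge0.
split=> [xl2|[M xM]].
  have xfin : l2norm x \is a fin_num by rewrite ge0_fin_numE.
  exists (fine (l2norm x)); apply/l2norm_leP; first exact: fine_ge0.
  by rewrite fineK.
have M0 : 0 <= M by case: xM.
by apply: (@le_lt_trans _ _ M%:E); [exact/l2norm_leP|exact: ltry].
Qed.

Lemma l2_le_fin x : l2 x -> exists2 M, l2_le x M & l2norm x = M%:E.
Proof.
move=> xl2; have x0 : (0 <= l2norm x)%E by exact: Lnorm_ge0.
have xfin : l2norm x \is a fin_num by rewrite ge0_fin_numE.
exists (fine (l2norm x)); last by rewrite fineK.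
by apply/l2norm_leP; [exact: fine_ge0 | rewrite fineK].
Qed.

Lemma l2_le_coord x M k : l2_le x M -> normc (x k) <= M.
Proof.
move=> [M0 /(_ k.+1)]; rewrite big_ord_recr /= => h.
rewrite -(ler_pXn2r (_ : 0 < 2)%N) ?nnegrE ?normc_ge0//.
by apply: le_trans h; rewrite lerDr sumr_ge0// => i _; rewrite sqr_ge0.
Qed.

Lemma l2_le_wid x M K : l2_le x M -> M <= K -> l2_le x K.
Proof.
move=> [M0 h] MK; split; first exact: le_trans MK.
by move=> n; apply: (le_trans (h n)); rewrite ler_sqr ?nnegrE// (le_trans M0).
Qed.

Lemma l2_le_dom x y M K : l2_le x M -> 0 <= K ->
  (forall k, normc (y k) <= K * normc (x k)) -> l2_le y (K * M).
Proof.
move=> [M0 h] K0 yx; split; first exact: mulr_ge0.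
move=> n; rewrite exprMn; apply: le_trans (ler_wpM2l (sqr_ge0 K) (h n)).
rewrite mulr_sumr; apply: ler_sum => k _; rewrite -exprMn.
by rewrite ler_sqr ?nnegrE ?mulr_ge0 ?normc_ge0.
Qed.

Lemma l2_leM x (d : seqC) M K : l2_le x M -> 0 <= K -> (forall k, normc (d k) <= K) ->
  l2_le (fun k => d k * x k) (K * M).
Proof.
move=> xM K0 dK; apply: (@l2_le_dom x (fun k => d k * x k)) => // k.
by rewrite normcM ler_wpM2r ?normc_ge0.
Qed.

Lemma l2_leZ x (z : C) M : l2_le x M -> l2_le (fun k => z * x k) (normc z * M).
Proof. by move=> xM; apply: l2_leM; rewrite ?normc_ge0. Qed.

Lemma l2_leN x M : l2_le x M -> l2_le (fun k => - x k) M.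
Proof.
move=> xM; rewrite -(mul1r M); apply: (@l2_le_dom x (fun k => - x k)) => // k.
by rewrite normcN mul1r.
Qed.

(* Weighted AM-GM: [normc (u + v) ^ 2 <= (1 + t) normc u ^ 2 + (1 + 1/t) normc v ^ 2]
   with [t = K / M]. *)
Lemma l2_leD x y M K : l2_le x M -> l2_le y K ->
  l2_le (fun k => x k + y k) (M + K).
Proof.
move=> xM yK; have [M0 hx] := xM; have [K0 hy] := yK.
have [M_eq0|M_neq0] := eqVneq M 0.
  have x0 k : x k = 0.
    apply/eq0_normc/eqP; rewrite eq_le normc_ge0 andbT -M_eq0.
    exact: l2_le_coord.
  by split=> [|n]; rewrite M_eq0 add0r//; under eq_bigr do rewrite x0 add0r.
have [K_eq0|K_neq0] := eqVneq K 0.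
  have y0 k : y k = 0.
    apply/eq0_normc/eqP; rewrite eq_le normc_ge0 andbT -K_eq0.
    exact: l2_le_coord.
  by split=> [|n]; rewrite K_eq0 addr0//; under eq_bigr do rewrite y0 addr0.
have Mp : 0 < M by rewrite lt_neqAle eq_sym M_neq0.
have Kp : 0 < K by rewrite lt_neqAle eq_sym K_neq0.
split=> [|n]; first exact: addr_ge0.
apply: (@le_trans _ _ ((1 + K / M) * \sum_(k < n) normc (x k) ^+ 2 +
   (1 + M / K) * \sum_(k < n) normc (y k) ^+ 2)).
  rewrite !mulr_sumr -big_split /=; apply: ler_sum => k _.
  have h := le_normcD (x k) (y k).
  apply: (@le_trans _ _ ((normc (x k) + normc (y k)) ^+ 2)).
    by rewrite ler_sqr ?nnegrE ?addr_ge0 ?normc_ge0.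
  rewrite -subr_ge0 (_ : _ - _ =
    (K * normc (x k) - M * normc (y k)) ^+ 2 / (M * K)); last by field; lra.
  by rewrite divr_ge0 ?sqr_ge0 ?mulr_ge0.
rewrite (_ : (M + K) ^+ 2 = (1 + K / M) * M ^+ 2 + (1 + M / K) * K ^+ 2); last first.
  by field; lra.
by apply: lerD; rewrite ler_wpM2l ?addr_ge0 ?divr_ge0.
Qed.

Lemma l2_leB x y M K : l2_le x M -> l2_le y K ->
  l2_le (fun k => x k - y k) (M + K).
Proof. by move=> xM yK; apply: l2_leD => //; exact: l2_leN. Qed.

Lemma l2_le_shift x M : l2_le x M -> l2_le (fun k => x k.+1) M.
Proof.
move=> [M0 h]; split=> // n; apply: le_trans (h n.+1).
by rewrite big_ord_recl /= lerDr sqr_ge0.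
Qed.

Definition l2_pre x : seqC := fun i => if i is j.+1 then x j else 0.

Lemma l2_le_pre x M : l2_le x M -> l2_le (l2_pre x) M.
Proof.
move=> [M0 h]; split=> // -[|n]; first by rewrite big_ord0 sqr_ge0.
by rewrite big_ord_recl /= normc0 expr0n add0r; exact: h.
Qed.

Lemma finitely_supported_l2 x : finitely_supported x -> l2 x.
Proof.
(* The inequality [s <= (1 + s) ^ 2] for [s >= 0] avoids a square root in the witness. *)
move=> [N hN]; apply/l2P; exists (1 + \sum_(k < N) normc (x k) ^+ 2).
have S0 n : 0 <= \sum_(k < n) normc (x k) ^+ 2.
  by apply: sumr_ge0 => k _; rewrite sqr_ge0.
split=> [|n]; first exact: addr_ge0.
suff : \sum_(k < n) normc (x k) ^+ 2 <= \sum_(k < N) normc (x k) ^+ 2.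
  by have := S0 N; nra.
have [nN|/ltnW Nn] := leqP n N.
  rewrite -!(big_mkord xpredT (fun k => normc (x k) ^+ 2)).
  rewrite [X in _ <= X](big_cat_nat (leq0n _) nN)//= lerDl sumr_ge0// => k _.
  by rewrite sqr_ge0.
rewrite -!(big_mkord xpredT (fun k => normc (x k) ^+ 2)).
rewrite (big_cat_nat (leq0n _) Nn)//= [X in _ + X](_ : _ = 0) ?addr0//.
rewrite big_nat_cond big1// => k.
by rewrite andbT => /andP[Nk _]; rewrite hN// normc0 expr0n.
Qed.

Definition l2_trunc N x : seqC := fun k => if (k < N)%N then x k else 0.

(** Tails of a convergent series are small. This gives the density of finitely supported sequences
    in l2, and also the decay of the coordinates of [x]. *)
Lemma l2_trunc_cvg x : l2 x -> forall e : R, 0 < e ->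
  exists N, l2_le (fun k => l2_trunc N x k - x k) e.
Proof.
move=> /l2P[M [M0 h]] e e0.
set S : R^nat := fun n => \sum_(0 <= k < n) normc (x k) ^+ 2.
have Snd : nondecreasing_seq S.
  by apply/nondecreasing_seqP => n; rewrite /S big_nat_recr//= lerDl sqr_ge0.
have Scvg : cvgn S.
  apply: nondecreasing_is_cvgn => //; exists (M ^+ 2) => _ [n _ <-].
  by rewrite /S big_mkord.
have [N _ hN] := cvgr_dist_lt _ _ Scvg _ (exprn_gt0 2 e0).
have {}hN := hN N (leqnn N).
exists N; split=> [|n]; first exact: ltW.
have [nN|/ltnW Nn] := leqP n N.
  rewrite big1 ?sqr_ge0// => k _.
  by rewrite /l2_trunc (leq_trans (ltn_ord k) nN) subrr normc0 expr0n.
have -> : \sum_(k < n) normc (l2_trunc N x k - x k) ^+ 2 = S n - S N.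
  rewrite -(big_mkord xpredT (fun k => normc (l2_trunc N x k - x k) ^+ 2)).
  rewrite /S [X in X - _](big_cat_nat (leq0n _) Nn)//= [X in _ = X - _]addrC addrK.
  rewrite (big_cat_nat (leq0n _) Nn)//= [X in X + _](_ : _ = 0) ?add0r; last first.
    rewrite big_nat_cond big1// => k; rewrite andbT => /andP[_ kN].
    by rewrite /l2_trunc kN subrr normc0 expr0n.
  apply: eq_big_nat => k /andP[Nk _].
  by rewrite /l2_trunc ltnNge Nk /= sub0r normcN.
have SnL : S n <= limn S by exact: nondecreasing_cvgn_le.
have := ler_norm (limn S - S N); lra.
Qed.

End L2.

(** * Row-finite infinite matrices acting on sequences *)

Section InfiniteMatrixAction.
Variable R : realType.
Local Notation C := (R[i]).
Local Notation seqC := (nat -> C).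
Implicit Types (x y : seqC) (A B : infmx R).

Lemma fsum_nat (f : seqC) n : (forall j, (n <= j)%N -> f j = 0) ->
  \sum_(j \in [set: nat]) f j = \sum_(j < n) f j.
Proof.
move=> f0; rewrite fsbig_ord; apply/esym/fsbig_widen => // j [_ /= /negP].
by rewrite -leqNgt => /f0.
Qed.

(** Only the part above the diagonal is constrained: this already makes every row finite, so that
    the sums over [nat] become finite sums. A lower triangular matrix such as [U^T] has [m = 0]. *)
Definition banded m A := forall i j, (i + m < j)%N -> A i j = 0.

Lemma infmx_act_banded m A x i n : banded m A -> (i + m < n)%N ->
  infmx_act A x i = \sum_(j < n) A i j * x j.
Proof.
by move=> bA mn; apply: fsum_nat => j nj; rewrite bA ?mul0r// (leq_trans mn).
Qed.

Lemma infmx_mul_banded m A B i k n : banded m A -> (i + m < n)%N ->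
  infmx_mul A B i k = \sum_(j < n) A i j * B j k.
Proof. exact: (@infmx_act_banded m A (B^~ k) i n). Qed.

Lemma banded_mul m1 m2 A B : banded m1 A -> banded m2 B ->
  banded (m1 + m2) (infmx_mul A B).
Proof.
move=> bA bB i k ik; rewrite (infmx_mul_banded _ _ bA (ltnSn _)) big1// => j _.
rewrite [X in _ * X]bB ?mulr0//; apply: leq_ltn_trans ik.
by rewrite addnA leq_add2r -ltnS.
Qed.

(** Finite rows allow the two sums to be exchanged whatever the sequence [x], in l2 or not. *)
Lemma infmx_act_mul m1 m2 A B x : banded m1 A -> banded m2 B ->
  infmx_act (infmx_mul A B) x = infmx_act A (infmx_act B x).
Proof.
move=> bA bB; apply/funext => i; set n := (i + m1).+1; set N := (i + (m1 + m2)).+1.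
rewrite (@infmx_act_banded _ _ _ _ N (banded_mul bA bB))//.
under eq_bigr do rewrite (@infmx_mul_banded _ _ _ _ _ n bA)// mulr_suml.
rewrite exchange_big (@infmx_act_banded _ _ _ _ n bA)//=; apply: eq_bigr => j _.
rewrite (@infmx_act_banded _ _ _ _ N bB) ?mulr_sumr; last first.
  by rewrite /N addnA ltnS leq_add2r -ltnS.
by apply: eq_bigr => k _; rewrite mulrA.
Qed.

Lemma banded_scalar z : banded 0 (@infmx_scalar R z).
Proof. by move=> i j; rewrite addn0 /infmx_scalar => /ltn_eqF ->. Qed.

Lemma infmx_act_add_scalar m A z x : banded m A ->
  infmx_act (infmx_add A (infmx_scalar z)) x = infmx_act A x \+ z \*o x.
Proof.
move=> bA; apply/funext => i; have n0 : (i + 0 < (i + m).+1)%N by rewrite ltnS leq_add2l.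
have bAz : banded m (infmx_add A (infmx_scalar z)).
  move=> j k jk; rewrite /infmx_add bA// banded_scalar ?addr0//.
  by rewrite addn0 (leq_ltn_trans _ jk)// leq_addr.
rewrite (@infmx_act_banded _ _ _ _ (i + m).+1 bAz)//.
rewrite /= (@infmx_act_banded _ _ _ _ (i + m).+1 bA)//.
have ->: z * x i = infmx_act (infmx_scalar z) x i.
  rewrite (infmx_act_banded _ (banded_scalar z) (ltnSn _)) addn0 big_ord_recr /=.
  rewrite /infmx_scalar eqxx big1 ?add0r// => j _.
  by rewrite eq_sym ltn_eqF ?mul0r.
rewrite (infmx_act_banded _ (banded_scalar z) n0) -big_split; apply: eq_bigr => j _.
by rewrite /infmx_add mulrDl.
Qed.

Definition seq_linear (F : seqC -> seqC) :=
  forall z x y, F (z \*o x \+ y) = z \*o F x \+ F y.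

Lemma infmx_act_linear m A : banded m A -> seq_linear (infmx_act A).
Proof.
move=> bA z x y; apply/funext => i; rewrite /=.
rewrite !(infmx_act_banded _ bA (ltnSn _)) mulr_sumr -big_split.
by apply: eq_bigr => j _ /=; ring.
Qed.

Section SeqLinear.
Variables (F : seqC -> seqC) (linF : seq_linear F).

Lemma seq_linearD x y : F (x \+ y) = F x \+ F y.
Proof.
have -> : x \+ y = 1 \*o x \+ y by apply/funext => k /=; rewrite mul1r.
by rewrite linF; apply/funext => k /=; rewrite mul1r.
Qed.

Lemma seq_linearB x y : F (x \- y) = F x \- F y.
Proof.
have -> : x \- y = -1 \*o y \+ x by apply/funext => k /=; ring.
by rewrite linF; apply/funext => k /=; ring.
Qed.

Lemma seq_linearZ z x : F (z \*o x) = z \*o F x.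
Proof.
have F0 : F (x \- x) = F x \- F x by rewrite seq_linearB.
have -> : z \*o x = z \*o x \+ (x \- x) by apply/funext => k /=; ring.
by rewrite linF F0; apply/funext => k /=; ring.
Qed.

End SeqLinear.

End InfiniteMatrixAction.

(** * Bounded maps of l2, their graphs and their resolvents *)

Section BoundedOperators.
Variable R : realType.
Local Notation C := (R[i]).
Local Notation seqC := (nat -> C).
Implicit Types (x y : seqC) (F G : seqC -> seqC) (z : C).

Definition l2_bounded F :=
  exists2 D : R, 0 <= D & forall x M, l2_le x M -> l2_le (F x) (D * M).

Lemma l2_bounded_l2 F x : l2_bounded F -> l2 x -> l2 (F x).
Proof.
by move=> [D _ FD] /l2P[M xM]; apply/l2P; exists (D * M); exact: FD.
Qed.

Lemma l2Z z x : l2 x -> l2 (z \*o x).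
Proof. move=> /l2P[M xM]; apply/l2P; exists (normc z * M); exact: l2_leZ. Qed.

Lemma l2B x y : l2 x -> l2 y -> l2 (x \- y).
Proof.
move=> /l2P[M xM] /l2P[K yK]; apply/l2P; exists (M + K); exact: l2_leB.
Qed.

Lemma l2_bounded_comp F G : l2_bounded F -> l2_bounded G -> l2_bounded (F \o G).
Proof.
move=> [D D0 FD] [E E0 GE]; exists (D * E); first exact: mulr_ge0.
by move=> x M xM; rewrite -mulrA; apply/FD/GE.
Qed.

Lemma l2_bounded_id : l2_bounded id.
Proof. by exists 1 => // x M xM; rewrite mul1r. Qed.

Lemma l2_bounded_add F G : l2_bounded F -> l2_bounded G ->
  l2_bounded (fun x => F x \+ G x).
Proof.
move=> [D D0 FD] [E E0 GE]; exists (D + E); first exact: addr_ge0.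
by move=> x M xM; rewrite mulrDl; apply: l2_leD; [exact: FD|exact: GE].
Qed.

Lemma l2_bounded_scale F z : l2_bounded F -> l2_bounded (fun x => z \*o F x).
Proof.
move=> [D D0 FD]; exists (normc z * D); first by rewrite mulr_ge0 ?normc_ge0.
by move=> x M xM; rewrite -mulrA; apply: l2_leZ; exact: FD.
Qed.

(** A bounded action has a closed graph, so the closure adds nothing outside it; conversely
    truncations approximate any [x] in l2 and their images follow by boundedness. *)
Lemma matrix_operatorP (A : infmx R) x y :
  seq_linear (infmx_act A) -> l2_bounded (infmx_act A) ->
  matrix_operator A x y <-> l2 x /\ y = infmx_act A x.
Proof.
move=> linA bndA; have [D D0 AD] := bndA; split=> [[xl2 yl2 h]|[xl2 ->]].
  split=> //; apply/funext => i; apply/eqP; rewrite -subr_eq0; apply/eqP.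
  apply: (@normc_le_eps _ _ (1 + D)) => e e0.
  have [v [_ /ltW vx /ltW vy]] := h e e0.
  have {}vx := (l2norm_leP _ (ltW e0)).1 vx.
  have {}vy := (l2norm_leP _ (ltW e0)).1 vy.
  rewrite mulrDl mul1r.
  have := l2_le_coord i (l2_leB (AD _ _ vx) vy); rewrite seq_linearB//= => h1.
  rewrite (_ : _ - _ = infmx_act A v i - infmx_act A x i - (infmx_act A v i - y i));
    last by ring.
  lra.
split=> [||e e0]; [exact: xl2|exact: (l2_bounded_l2 bndA xl2)|].
(* With this tolerance both the truncation error and its image, at most [D] times larger, stay below
   [e / 2]; the [+ 1] covers [D = 0], and the halving gives the strict inequalities. *)
have e1 : 0 < e / 2 / (D + 1) by rewrite !divr_gt0// ltr_wpDl.
have [N hN] := l2_trunc_cvg xl2 e1.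
have e1e : e / 2 / (D + 1) <= e / 2 by rewrite ler_pdivrMr ?ltr_wpDl//; nra.
exists (l2_trunc N x); split; first by exists N => n; rewrite leqNgt /l2_trunc => /negbTE ->.
  apply: (@le_lt_trans _ _ (e / 2)%:E); last by rewrite lte_fin; lra.
  by apply/l2norm_leP; [lra | exact: l2_le_wid hN _].
apply: (@le_lt_trans _ _ (e / 2)%:E); last by rewrite lte_fin; lra.
apply/l2norm_leP; first lra.
rewrite -seq_linearB//; apply: l2_le_wid (AD _ _ hN) _.
by rewrite mulrCA ler_piMr ?ler_pdivrMr ?ltr_wpDl//; lra.
Qed.

Definition seq_resolvent F z (B : seqC -> seqC) :=
  [/\ l2_bounded B, forall y, l2 y -> F (B y) = y \+ z \*o B y
    & forall x, l2 x -> B (F x \- z \*o x) = x].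

Lemma is_resolventP (A : infmx R) z B :
  seq_linear (infmx_act A) -> l2_bounded (infmx_act A) ->
  is_resolvent (matrix_operator A) z B <-> seq_resolvent (infmx_act A) z B.
Proof.
move=> linA bndA; split=> [[h1 h2 [M hM]]|[bB h1 h2]]; split.
- exists `|M| => // y K yK; have K0 : 0 <= K by case: yK.
  apply/l2norm_leP; first exact: mulr_ge0.
  apply: (le_trans (hM y _)); first by apply/l2P; exists K.
  rewrite EFinM; apply: (@le_trans _ _ (`|M|%:E * l2norm y)%E).
    by rewrite lee_wpmul2r ?lee_fin ?ler_norm//; exact: Lnorm_ge0.
  by rewrite lee_wpmul2l ?lee_fin//; apply/l2norm_leP.
- by move=> y yl2; have /matrix_operatorP[]// := h1 y yl2.
- by move=> x xl2; apply: h2; apply/matrix_operatorP.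
- move=> y yl2; apply/matrix_operatorP => //; split; first exact: l2_bounded_l2.
  by rewrite h1.
- by move=> x y /matrix_operatorP[]// xl2 ->; exact: h2.
- have [D D0 BD] := bB; exists D => y /l2_le_fin[K yK ->].
  by rewrite -EFinM; apply/l2norm_leP; [rewrite mulr_ge0//; case: yK|exact: BD].
Qed.

(* The classical formula [(GF - w)^-1 = w^-1 (G (FG - w)^-1 F - 1)]. *)
Lemma seq_resolvent_swap F G kappa z B :
  seq_linear F -> seq_linear G -> l2_bounded F -> l2_bounded G -> z != kappa ->
  seq_resolvent (fun x => F (G x) \+ kappa \*o x) z B ->
  seq_resolvent (fun x => G (F x) \+ kappa \*o x) z
    (fun y => (z - kappa)^-1 \*o (G (B (F y)) \- y)).
Proof.
move=> linF linG bF bG; rewrite -subr_eq0 => zk [bB h1 h2]; split.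
- apply: l2_bounded_scale.
  have := l2_bounded_add (l2_bounded_comp bG (l2_bounded_comp bB bF))
    (l2_bounded_scale (-1) l2_bounded_id).
  congr l2_bounded; apply/funext => y; apply/funext => k /=.
  by rewrite mulN1r.
- move=> y yl2; rewrite (seq_linearZ linF) (seq_linearB linF).
  have /(congr1 (fun u => u \- kappa \*o B (F y))) := h1 _ (l2_bounded_l2 bF yl2).
  set b := B (F y); have -> : F (G b) \+ kappa \*o b \- kappa \*o b = F (G b).
    by apply/funext => k /=; ring.
  move=> ->; have -> : (z - kappa)^-1 \*o (F y \+ z \*o b \- kappa \*o b \- F y) = b.
    apply/funext => k /=; rewrite (_ : _ - _ - _ = (z - kappa) * b k); last by ring.
    by rewrite mulKf.
  by apply/funext => k /=; field.
- move=> x xl2.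
  have -> : F (G (F x) \+ kappa \*o x \- z \*o x) =
      (F (G (F x)) \+ kappa \*o F x) \- z \*o F x.
    by rewrite (seq_linearB linF) (seq_linearD linF) !(seq_linearZ linF).
  rewrite h2; last exact: l2_bounded_l2.
  by apply/funext => k /=; field.
Qed.

End BoundedOperators.

(** * The contraction principle in l2, with limits taken coordinatewise *)

Section Contraction.
Variable R : realType.
Local Notation C := (R[i]).
Local Notation seqC := (nat -> C).
Implicit Types (x y : seqC) (F G : seqC -> seqC) (z : C).

Lemma geometric_increments_cvg (u : R^nat) (K q : R) : 0 <= q < 1 ->
  (forall n, `|u n.+1 - u n| <= K * q ^+ n) -> cvgn u.
Proof.
move=> /andP[q0 q1] h; have -> : u = (fun n => u 0%N + series (telescope u) n).
  by apply/funext => n; exact: eq_sum_telescope.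
apply: is_cvgD; first exact: is_cvg_cst.
apply: normed_cvg; apply: (@series_le_cvg _ _ (geometric K q)).
- by move=> n; exact: normr_ge0.
- by move=> n; apply: le_trans (h n); exact: normr_ge0.
- by move=> n; exact: h.
- by apply: is_cvg_geometric_series; rewrite ger0_norm.
Qed.

Lemma geometric_le_eps (q : R) : 0 <= q < 1 -> forall e : R, 0 < e ->
  exists n, q ^+ n <= e.
Proof.
move=> /andP[q0 q1] e e0.
have q1' : `|q| < 1 by rewrite ger0_norm.
have [N _ hN] := cvgr_dist_lt _ _ (cvg_geometric 1 q1') _ e0.
exists N; have := hN N (leqnn N).
by rewrite /geometric /= sub0r normrN mul1r ger0_norm ?exprn_ge0// => /ltW.
Qed.

(** Lower semicontinuity of the norm: each partial sum depends continuously on finitely many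
    coordinates, so its bound survives coordinatewise limits. *)
Lemma l2_le_lim (s : nat -> seqC) x M :
  (forall k, (fun n => complex.Re (s n k)) @ \oo --> complex.Re (x k)) ->
  (forall k, (fun n => complex.Im (s n k)) @ \oo --> complex.Im (x k)) ->
  (forall n, l2_le (s n) M) -> l2_le x M.
Proof.
move=> hRe hIm sM; split=> [|n]; first by case: (sM 0%N).
have h : (fun m => \sum_(k < n) normc (s m k) ^+ 2) @ \oo -->
    \sum_(k < n) normc (x k) ^+ 2.
  elim: n => [|n IHn].
    by under eq_cvg do rewrite big_ord0; rewrite big_ord0; exact: cvg_cst.
  under eq_cvg do rewrite big_ord_recr /=; rewrite big_ord_recr /=.
  apply: cvgD => //; rewrite sqr_normc.
  under eq_cvg do rewrite sqr_normc.
  by apply: cvgD; rewrite expr2; under eq_cvg do rewrite expr2; apply: cvgM.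
rewrite -(cvg_lim _ h)//; apply: limr_le; first by apply/cvg_ex; eexists; exact: h.
by apply: nearW => m; case: (sM m).
Qed.

Lemma l2_contraction_fixpoint F (q K : R) (g : seqC) :
  seq_linear F -> 0 <= q < 1 ->
  (forall x M, l2_le x M -> l2_le (F x) (q * M)) -> l2_le g K ->
  exists2 x, l2_le x (K / (1 - q)) & x = F x \+ g.
Proof.
move=> linF q01 Fq gK; have /andP[q0 q1] := q01; have K0 : 0 <= K by case: gK.
set D := K / (1 - q); have q1' : 1 - q != 0 by rewrite subr_eq0 gt_eqF.
(* [D] is the fixed point of [r |-> q r + K], so the ball of radius [D] is mapped into itself and
   contains every iterate. *)
have DE : q * D + K = D by rewrite /D; field.
have D0 : 0 <= D by rewrite divr_ge0// subr_ge0 ltW.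
pose s := fix s n : seqC := if n is m.+1 then F (s m) \+ g else fun=> 0.
have sD n : l2_le (s n) D.
  elim: n => [|n IHn] /=.
    by split=> // n; rewrite big1 ?sqr_ge0// => k _; rewrite normc0 expr0n.
  by rewrite -DE; apply: l2_leD => //; exact: Fq.
have sC n j : l2_le (s (n + j)%N \- s n) (q ^+ n * D).
  elim: n => [|n IHn].
    rewrite add0n expr0 mul1r; congr l2_le: (sD j).
    by apply/funext => k; rewrite /= subr0.
  rewrite exprS -mulrA; have := Fq _ _ IHn; rewrite seq_linearB//.
  by congr l2_le; apply/funext => k /=; ring.
have sc n k : normc (s n.+1 k - s n k) <= D * q ^+ n.
  by rewrite mulrC -addn1; exact: l2_le_coord (sC n 1%N).
have cRe k : cvgn (fun n => complex.Re (s n k)).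
  apply: (geometric_increments_cvg q01) => n; apply: le_trans (sc n k).
  by rewrite -ReN -ReD Re_le_normc.
have cIm k : cvgn (fun n => complex.Im (s n k)).
  apply: (geometric_increments_cvg q01) => n; apply: le_trans (sc n k).
  by rewrite -ImN -ImD Im_le_normc.
pose x : seqC := fun k => limn (fun n => complex.Re (s n k)) +i*
  limn (fun n => complex.Im (s n k)).
(* The bound [sC] is uniform in [j]; letting [j] tend to infinity upgrades coordinatewise
   convergence to convergence in norm. *)
have xs n : l2_le (x \- s n) (q ^+ n * D).
  apply: (@l2_le_lim (fun j => s (n + j)%N \- s n)) => [k|k|j]; last exact: sC.
    under eq_cvg do rewrite /= ReD ReN; rewrite /= ReD ReN.
    apply: cvgB; last exact: cvg_cst.
    under eq_cvg do rewrite addnC.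
    by have := cRe k; rewrite -(cvg_shiftn n); exact.
  under eq_cvg do rewrite /= ImD ImN; rewrite /= ImD ImN.
  apply: cvgB; last exact: cvg_cst.
  under eq_cvg do rewrite addnC.
  by have := cIm k; rewrite -(cvg_shiftn n); exact.
exists x; first by have := xs 0%N; rewrite expr0 mul1r; congr l2_le;
  apply/funext => k; rewrite /= subr0.
apply/funext => k; apply/eqP; rewrite -subr_eq0; apply/eqP.
apply: (@normc_le_eps _ _ (2 * D)) => e e0.
have [n qn] := geometric_le_eps q01 e0.
have h1 := l2_le_coord k (xs n.+1); have h2 := l2_le_coord k (Fq _ _ (xs n)).
(* Since [s n.+1 = F (s n) + g], the defect of [x] splits into two errors, each at most
   [q ^ (n + 1) * D]. *)
have -> : x k - (F x \+ g) k = (x \- s n.+1) k - F (x \- s n) k.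
  by rewrite seq_linearB//=; ring.
apply: le_trans (normcB _ _) _; apply: le_trans (lerD h1 h2) _.
have qe : q * q ^+ n <= e by apply: le_trans qn; rewrite ler_piMl ?exprn_ge0// ltW.
rewrite exprS (_ : _ + _ = 2 * D * (q * q ^+ n)); last by ring.
by rewrite ler_wpM2l// mulr_ge0.
Qed.

End Contraction.

(** * Non-real points are regular for a bounded Jacobi operator; self-adjointness enters as the
    reality of [a] and [b] *)

Section SelfAdjointJacobi.
Variable R : realType.
Local Notation C := (R[i]).
Local Notation seqC := (nat -> C).
Variables (a b : nat -> R) (F : seqC -> seqC) (A : R).
Hypothesis linF : seq_linear F.
Hypothesis bndF : l2_bounded F.
Hypothesis aA : forall i, `|a i| <= A.
Hypothesis FE : forall x i, F x i = (b i)%:C * x i + (a i)%:C * x i.+1 +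
  (if i is j.+1 then (a j)%:C * x j else 0).

(* The Green identity: [Im (conj (x k) * (F x) k)] telescopes. *)
Lemma jacobi_green (r : R) (x : seqC) n :
  \sum_(k < n.+1) (complex.Re (x k) * complex.Im (F x k - r%:C * x k)
    - complex.Im (x k) * complex.Re (F x k - r%:C * x k)) =
  a n * (complex.Re (x n) * complex.Im (x n.+1) -
         complex.Im (x n) * complex.Re (x n.+1)).
Proof.
elim: n => [|n IHn].
  by rewrite big_ord_recr big_ord0 /= FE !ReImE /=; ring.
by rewrite big_ord_recr /= IHn FE !ReImE /=; ring.
Qed.

(** The boundary term left by the Green identity is [a m * Im (conj (x m) * x m.+1)], which tends to
    [0] for [x] in l2. With [Num.min 1 e], one coordinate is bounded by [1] and the other by [e]. *)
Lemma jacobi_boundary_le (x : seqC) : l2 x -> forall e, 0 < e -> forall n,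
  exists2 m, (n <= m)%N & `|a m * (complex.Re (x m) * complex.Im (x m.+1) -
         complex.Im (x m) * complex.Re (x m.+1))| <= A * e.
Proof.
move=> xl2 e e0 n.
have e1 : 0 < Num.min 1 e by rewrite lt_min ltr01.
have [N hN] := l2_trunc_cvg xl2 e1; exists (maxn n N); first exact: leq_maxl.
set m := maxn n N; have small k : (N <= k)%N -> normc (x k) <= Num.min 1 e.
  move=> Nk; have := l2_le_coord k hN.
  by rewrite /l2_trunc ltnNge Nk /= sub0r normcN.
have := small m (leq_maxr _ _); have := small m.+1 (leqW (leq_maxr _ _)).
rewrite !le_min => /andP[_ h2] /andP[h1 _].
rewrite normrM ler_pM//.
apply: (@le_trans _ _ (normc (x m) * normc (x m.+1))); last first.
  by rewrite -[e]mul1r ler_pM ?normc_ge0.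
rewrite -(normcN (x m)) -(_ : normc ((x m)^*) = normc (- x m)); last first.
  by case: (x m) => u v; rewrite /normc /= !sqrrN.
rewrite -normcM; apply: le_trans (Im_le_normc _).
by rewrite ImM; case: (x m) => u v /=; rewrite mulNr.
Qed.

Variable z : C.
Hypothesis z_nonreal : complex.Im z != 0.

Let beta := complex.Im z.

(* With [F - z = H - i beta], [H] self-adjoint, one has
   [1 - i tau (F - z) = (1 - tau beta) - i tau H], whose cross terms cancel. *)
Lemma jacobi_step_contraction : exists tau q : R, [/\ tau != 0, 0 <= q < 1 &
  forall x M, l2_le x M ->
    l2_le (x \- (0 +i* tau) \*o (F x \- z \*o x)) (q * M)].
Proof.
have [D D0 FD] := bndF; set r := complex.Re z; set E := D + `|r|.
have E0 : 0 <= E by rewrite addr_ge0.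
have b2 : 0 < beta ^+ 2 by rewrite exprn_even_gt0.
have S0 : 0 < beta ^+ 2 + E ^+ 2 by rewrite ltr_wpDr ?sqr_ge0.
(* Here [E] bounds [H = F - Re z], and this [tau] minimizes [(1 - tau beta) ^ 2 + tau ^ 2 E ^ 2],
   with minimum [Q = E ^ 2 / S < 1]. *)
set S := beta ^+ 2 + E ^+ 2; set tau := beta / S.
set Q := E ^+ 2 / S; have Q0 : 0 <= Q by rewrite divr_ge0 ?sqr_ge0 ?ltW.
have Q1 : Q < 1 by rewrite ltr_pdivrMr// mul1r ltrDr.
exists tau, (Num.sqrt Q); split.
- by rewrite mulf_neq0 ?z_nonreal// invr_eq0 gt_eqF.
- by rewrite sqrtr_ge0 -sqrtr1 ltr_sqrt.
move=> x M xM; have [M0 hM] := xM.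
have HM : l2_le (fun k => F x k - r%:C * x k) (E * M).
  rewrite mulrDl; apply: l2_leB; first exact: FD.
  by rewrite -normc_real; exact: l2_leZ.
have [_ hH] := HM.
set y := fun k => F x k - r%:C * x k.
set w := fun m => a m * (complex.Re (x m) * complex.Im (x m.+1) -
         complex.Im (x m) * complex.Re (x m.+1)).
set al := 1 - tau * beta.
have split_norm m : \sum_(k < m.+1)
    normc ((x \- (0 +i* tau) \*o (F x \- z \*o x)) k) ^+ 2 =
   al ^+ 2 * (\sum_(k < m.+1) normc (x k) ^+ 2) +
   tau ^+ 2 * (\sum_(k < m.+1) normc (y k) ^+ 2) + 2 * al * tau * w m.
  rewrite /w -(jacobi_green r) !mulr_sumr -!big_split /=; apply: eq_bigr => k _.
  rewrite !sqr_normc /y !ReImE /= -/r -/beta /al; ring.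
split=> [|n]; first by rewrite mulr_ge0 ?sqrtr_ge0.
(* The cross terms vanish only in the limit. The sum up to [n] is therefore enlarged to a sum up to
   some [m >= n] at which the boundary term is at most [e]. *)
apply/ler_addgt0Pr => e e0; rewrite exprMn sqr_sqrtr//.
have A0 : 0 <= A by apply: le_trans (aA 0%N); exact: normr_ge0.
set B := `|2 * al * tau| * A.
have B0 : 0 < B + 1 by rewrite ltr_wpDl// mulr_ge0.
have [|m nm hm] := @jacobi_boundary_le x _ (e / (B + 1)) (divr_gt0 e0 B0) n.
  by apply/l2P; exists M.
apply: (@le_trans _ _ (\sum_(k < m.+1)
    normc ((x \- (0 +i* tau) \*o (F x \- z \*o x)) k) ^+ 2)).
  rewrite -!(big_mkord xpredT (fun k => normc ((x \- (0 +i* tau) \*o (F x \- z \*o x)) k) ^+ 2)).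
  rewrite [leRHS](big_cat_nat (leq0n _) (leqW nm))//= lerDl sumr_ge0// => k _.
  exact: sqr_ge0.
rewrite split_norm; apply: lerD.
  apply: (@le_trans _ _ (al ^+ 2 * M ^+ 2 + tau ^+ 2 * (E * M) ^+ 2)).
    by apply: lerD; rewrite ler_wpM2l ?sqr_ge0//.
  rewrite le_eqVlt; apply/orP; left; apply/eqP.
  by rewrite /al /tau /Q /S; field; rewrite gt_eqF.
apply: le_trans (ler_norm _) _; rewrite normrM.
apply: (@le_trans _ _ (`|2 * al * tau| * (A * (e / (B + 1))))).
  by rewrite ler_wpM2l.
by rewrite mulrA -/B mulrCA ger_pMr// ler_pdivrMr// mul1r lerDl.
Qed.

(** With [t = i tau], the equation [(F - z) x = y] is equivalent to [x = (1 - t (F - z)) x + t y], a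
    fixed-point equation for a contraction. *)
Lemma jacobi_resolvent_nonreal : exists B, seq_resolvent F z B.
Proof.
have [tau [q [tau0 q01 Sq]]] := jacobi_step_contraction.
have /andP[q0 q1] := q01; set t : C := 0 +i* tau in Sq.
have t0 : t != 0 by apply: contraNneq tau0 => -[->].
pose T x := F x \- z \*o x.
have linS : seq_linear (fun x => x \- t \*o T x).
  by move=> u x y; rewrite /T linF; apply/funext => k /=; ring.
(* The condition [l2 y] sits under the existential so that [choice] yields a function on all
   sequences; its values outside l2 are arbitrary. *)
have solve y : exists x, l2 y -> F x \- z \*o x = y /\
    forall K, l2_le y K -> l2_le x (normc t / (1 - q) * K).
  have [/l2_le_fin[K yK yE]|/asboolPn] := pselect (l2 y); last first.
    by move=> ny; exists y => /asboolP; rewrite (negbTE ny).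
  have [x xK xE] := l2_contraction_fixpoint linS q01 Sq (l2_leZ t yK).
  exists x => _; split.
    apply/funext => k; have /(congr1 (fun f : seqC => f k)) /= := xE.
    move=> /eqP; rewrite -subr_eq0 => /eqP h; apply: (mulfI t0).
    by apply/eqP; rewrite -subr_eq0 -h; apply/eqP; rewrite /T /=; ring.
  move=> K' yK'; apply: l2_le_wid xK _; rewrite mulrAC ler_wpM2l//.
    by rewrite divr_ge0 ?normc_ge0 ?subr_ge0 ?ltW.
  by rewrite -lee_fin -yE; apply/l2norm_leP => //; case: yK'.
have [B hB] := choice solve; exists B; split.
- exists (normc t / (1 - q)); first by rewrite divr_ge0 ?normc_ge0 ?subr_ge0 ?ltW.
  by move=> y K yK; apply: (hB y _).2 => //; apply/l2P; exists K.
- move=> y yl2; have [/(congr1 (fun f => f \+ z \*o B y)) <- _] := hB y yl2.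
  by apply/funext => k /=; ring.
- move=> x xl2; set y := F x \- z \*o x.
  have yl2 : l2 y by apply: l2B; [exact: l2_bounded_l2|exact: l2Z].
  have [BE hK] := hB y yl2.
  have Byl2 : l2 (B y).
    by move/l2P: yl2 => [K yK]; apply/l2P; exists (normc t / (1 - q) * K); exact: hK.
  (* Uniqueness: [d = B y - x] is killed by [F - z], hence fixed by the contraction, so its norm [K]
     satisfies [K <= q K] and vanishes. *)
  have dl2 := l2B Byl2 xl2.
  have TE : F (B y \- x) \- z \*o (B y \- x) = (fun=> 0).
    rewrite seq_linearB//; apply/funext => k.
    have /(congr1 (fun f : seqC => f k)) /= := BE; rewrite /y /= => h.
    transitivity ((F (B y) k - z * B y k) - (F x k - z * x k)); first by rewrite /=; ring.
    by rewrite h subrr.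
  have [K dK KE] := l2_le_fin dl2.
  have := Sq _ _ dK; rewrite TE.
  have -> : B y \- x \- t \*o (fun=> 0) = B y \- x by apply/funext => k /=; ring.
  move=> /l2norm_leP; rewrite KE lee_fin => h.
  have K0 : K = 0 by case: dK => K0 _; have := h (mulr_ge0 q0 K0); nra.
  apply/funext => k; apply/eqP; rewrite -subr_eq0; apply/eqP/eq0_normc/eqP.
  by rewrite eq_le normc_ge0 andbT -K0; exact: l2_le_coord dK.
Qed.

End SelfAdjointJacobi.

(** * Orthogonal polynomials and the parameters [t_j] *)

Section GeronimusParameters.
Variable R : realType.
Local Notation C := (R[i]).
Variables (L : {scalar {poly C}}) (P : nat -> {poly C}) (c lam : nat -> R).
Hypothesis hL : positive_definite L.
Hypothesis hL1 : L 1 = 1.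
Hypothesis hP : monic_orthogonal L P.
Hypothesis hrec : three_term_recurrence P c lam.

Lemma recurrenceE n : P n.+2 =
  'X * P n.+1 - (c n.+2)%:C *: P n.+1 - (lam n.+2)%:C *: P n.
Proof. by case: hrec => _ _ /(_ n.+1 isT) -> /=; rewrite addrAC addrK addrK. Qed.

Lemma orthogonal_real n (x : R) : complex.Im (P n).[x%:C] = 0.
Proof.
have [P0 P1 _] := hrec.
suff : complex.Im (P n).[x%:C] = 0 /\ complex.Im (P n.+1).[x%:C] = 0 by case.
elim: n => [|n [IH1 IH2]].
  by rewrite P0 P1 !hornerE /= subr0.
split=> //; rewrite recurrenceE !hornerE !ReImE IH1 IH2 /=; ring.
Qed.

Lemma orthogonal_norm_gt0 n : 0 < L (P n * P n).
Proof.
have [mP _ _] := hP; apply: hL; first by rewrite mulf_neq0 ?monic_neq0.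
move=> x; rewrite hornerM -[_.[_]]RRe_real ?complex_real; last first.
  by move: (orthogonal_real n x); case: _.[_] => u v /= ->; rewrite complex_real.
by rewrite -rmorphM ler0c -expr2 sqr_ge0.
Qed.

(** Expanding [L (X P_(n+1) P_n)] by the recurrence for [X P_(n+1)] and by that for [X P_n] gives
    [L (P_(n+1)^2) = lam_(n+2) L (P_n^2)], with both values of [L] positive. *)
Lemma recurrence_lam_gt0 n : 0 < lam n.+2.
Proof.
have [_ _ orth] := hP; have [P0 P1 _] := hrec.
suff E : L (P n.+1 * P n.+1) = (lam n.+2)%:C * L (P n * P n).
  have := orthogonal_norm_gt0 n.+1.
  by rewrite E pmulr_lgt0 ?orthogonal_norm_gt0// ltcR.
have E1 : L ('X * P n.+1 * P n) = (lam n.+2)%:C * L (P n * P n).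
  have -> : 'X * P n.+1 * P n = P n.+2 * P n + (c n.+2)%:C *: (P n.+1 * P n) +
      (lam n.+2)%:C *: (P n * P n).
    by rewrite recurrenceE -!mul_polyC; ring.
  rewrite !linearD !linearZ /= (orth n.+2 n) ?(orth n.+1 n); try by lia.
  by rewrite mulr0 !add0r.
rewrite -E1; case: n {E1} => [|n].
  have -> : 'X * P 1%N * P 0%N = P 1%N * P 1%N + (c 1%N)%:C *: (P 1%N * P 0%N).
    by rewrite P0 P1 -!mul_polyC; ring.
  by rewrite linearD linearZ /= (orth 1 0)%N ?mulr0 ?addr0//.
have -> : 'X * P n.+2 * P n.+1 = P n.+2 * P n.+2 +
    (c n.+2)%:C *: (P n.+2 * P n.+1) + (lam n.+2)%:C *: (P n.+2 * P n).
  by rewrite {2}recurrenceE -!mul_polyC; ring.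
rewrite !linearD !linearZ /= (orth n.+2 n) ?(orth n.+2 n.+1); try by lia.
by rewrite !mulr0 !addr0.
Qed.

Definition difference_quotient n (z : C) :=
  ((P n).[z]%:P - P n) %/ (z%:P - 'X).

Lemma difference_quotientE n z :
  difference_quotient n z * (z%:P - 'X) = (P n).[z]%:P - P n.
Proof.
rewrite divpK// -opprB dvdpNl dvdp_XsubCl /root !hornerE subrr.
exact: eqxx.
Qed.

Lemma subCX_neq0 z : z%:P - 'X != 0 :> {poly C}.
Proof. by rewrite -opprB oppr_eq0 polyXsubC_eq0. Qed.

Lemma second_kind0 z : second_kind L P 0 z = 0.
Proof.
by have [P0 _ _] := hrec; rewrite /second_kind P0 hornerC subrr div0p linear0.
Qed.

Lemma second_kind1 z : second_kind L P 1 z = 1.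
Proof.
have [_ P1 _] := hrec; rewrite /second_kind -hL1; congr (L _).
apply: (mulIf (subCX_neq0 z)); rewrite -/(difference_quotient 1 z).
rewrite difference_quotientE P1 !hornerE polyCB; ring.
Qed.

(** Writing [z P(z) - y P(y) = z (P(z) - P(y)) + (z - y) P(y)] with [P = P_(n+1)], the quotient by
    [z - y] satisfies the recurrence of [P] up to the extra term [P_(n+1)(y)], which [L] kills by
    orthogonality to [P_0 = 1]. *)
Lemma second_kind_rec n z : second_kind L P n.+2 z =
  (z - (c n.+2)%:C) * second_kind L P n.+1 z - (lam n.+2)%:C * second_kind L P n z.
Proof.
have [_ _ orth] := hP; have [P0 _ _] := hrec.
have LP : L (P n.+1) = 0 by rewrite -[P _]mulr1 -P0 orth.
rewrite -[LHS]subr0 -LP /second_kind.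
rewrite -!/(difference_quotient _ z) -!linearZ -!linearB; congr (L _).
apply: (mulIf (subCX_neq0 z)); rewrite !mulrBl.
rewrite -!scalerAl !difference_quotientE recurrenceE !hornerE.
rewrite -!mul_polyC !(polyCB, polyCM, polyCD); ring.
Qed.

Variables (kappa s0 : C).
Hypothesis hhalf : (0 < complex.Im kappa /\ complex.Im s0 <= 0) \/
                   (complex.Im kappa < 0 /\ 0 <= complex.Im s0).

Let Rn n := geronimus_R L P s0 n kappa.
Let t := geronimus_t L P kappa s0.

Lemma geronimus_R0 : Rn 0 = 1.
Proof.
have [P0 _ _] := hrec.
by rewrite /Rn /geronimus_R second_kind0 P0 hornerC mulr0 addr0.
Qed.

Lemma geronimus_R1 : Rn 1 = kappa - (c 1%N)%:C + s0^-1.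
Proof.
have [_ P1 _] := hrec.
by rewrite /Rn /geronimus_R second_kind1 P1 !hornerE.
Qed.

Lemma geronimus_R_rec n :
  Rn n.+2 = (kappa - (c n.+2)%:C) * Rn n.+1 - (lam n.+2)%:C * Rn n.
Proof. rewrite /Rn /geronimus_R second_kind_rec recurrenceE !hornerE; ring. Qed.

Lemma geronimus_t1 : t 1 = (c 1%N)%:C - kappa - s0^-1.
Proof. by rewrite /t /= -/(Rn 1) -/(Rn 0) geronimus_R0 geronimus_R1 divr1; ring. Qed.

(** Inversion reverses the sign of the imaginary part. It is used with [u = kappa] and [z] equal to
    [s0] or [t_j]. *)
Lemma Im_inv_mul_ge0 (u z : C) (r : R) : 0 <= r ->
  complex.Im u * complex.Im z <= 0 ->
  0 <= complex.Im u * complex.Im (r%:C * z^-1).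
Proof.
case: u z => [u1 u2] [z1 z2] r0 /= h.
rewrite mul0r addr0 mulrCA mulr_ge0// mulrN -mulNr mulrA mulNr.
by rewrite divr_ge0 ?addr_ge0 ?sqr_ge0// oppr_ge0.
Qed.

(* [Im t_j] keeps the sign opposite to [Im kappa]: in
   [t_(j+1) = c_(j+1) - kappa - lam_(j+1) / t_j] the inverse only pushes it
   further away from [0]. *)
Lemma geronimus_t_spec j : [/\ Rn j != 0, Rn j.+1 != 0,
  complex.Im kappa * complex.Im (t j.+1) <= - complex.Im kappa ^+ 2 &
  t j.+2 = (c j.+2)%:C - kappa - (lam j.+2)%:C / t j.+1].
Proof.
have k0 : 0 < complex.Im kappa ^+ 2.
  by rewrite exprn_even_gt0//=; case: hhalf => -[h _]; rewrite ?(gt_eqF h) ?(lt_eqF h).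
have t_neq0 i : complex.Im kappa * complex.Im (t i) <= - complex.Im kappa ^+ 2 ->
    t i != 0.
  by apply: contraTneq => ->; rewrite /= mulr0 -ltNge oppr_lt0.
have R_neq0 i : complex.Im kappa * complex.Im (t i.+1) <= - complex.Im kappa ^+ 2 ->
    Rn i.+1 != 0.
  by move=> /t_neq0; apply: contraNneq; rewrite /t /= -/(Rn i.+1) => ->; rewrite mul0r oppr0.
have t_rec i : Rn i != 0 -> Rn i.+1 != 0 ->
    t i.+2 = (c i.+2)%:C - kappa - (lam i.+2)%:C / t i.+1.
  move=> Ri0 Ri1; rewrite /t /= -/(Rn i.+2) -/(Rn i.+1) -/(Rn i) geronimus_R_rec.
  by field; rewrite Ri0 Ri1.
(* The claims feed one another: the recurrence for [t] needs nonzero [R_j], and [R_(j+1)] is nonzero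
   because the bound on [Im t_(j+1)] excludes [t_(j+1) = - R_(j+1) / R_j = 0]. *)
elim: j => [|j [Rj0 Rj1 imt tE]].
  have im1 : complex.Im kappa * complex.Im (t 1) <= - complex.Im kappa ^+ 2.
    have -> : t 1 = (c 1%N)%:C - kappa - 1%:C * s0^-1.
      by rewrite geronimus_t1 mul1r.
    have : 0 <= complex.Im kappa * complex.Im (1%:C * s0^-1).
      by apply: Im_inv_mul_ge0 => //; case: hhalf => -[h1 h2]; nra.
    rewrite !ImD !ImN; move: (complex.Im (1%:C * _)) => w /=; lra.
  have R0 : Rn 0 != 0 by rewrite geronimus_R0 oner_neq0.
  by split=> //; [exact: R_neq0|apply: t_rec => //; exact: R_neq0].
have im2 : complex.Im kappa * complex.Im (t j.+2) <= - complex.Im kappa ^+ 2.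
  have : 0 <= complex.Im kappa * complex.Im ((lam j.+2)%:C * (t j.+1)^-1).
    by apply: Im_inv_mul_ge0; [exact/ltW/recurrence_lam_gt0|lra].
  rewrite tE !ImD !ImN; move: (complex.Im (_ * _)) => w /=; lra.
by split=> //; [exact: R_neq0|apply: t_rec => //; exact: R_neq0].
Qed.

Lemma geronimus_t_ge j : `|complex.Im kappa| <= normc (t j.+1).
Proof.
have [_ _ h _] := geronimus_t_spec j; apply: le_trans (Im_le_normc _).
have [->|k0] := eqVneq (complex.Im kappa) 0; first by rewrite normr0.
rewrite -(ler_pM2l (_ : 0 < `|complex.Im kappa|)) ?normr_gt0// -!normrM.
rewrite -expr2 (ger0_norm (sqr_ge0 _)) ler_normr; apply/orP; right; lra.
Qed.

End GeronimusParameters.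

(** * Jacobi and bidiagonal matrices as operators, and the m-function *)

Section TridiagonalMatrices.
Variable R : realType.
Local Notation C := (R[i]).
Local Notation seqC := (nat -> C).
Implicit Types (x : seqC).

Lemma banded_bidiagonal (u rt : seqC) : banded 1 (bidiagonal_mx u rt).
Proof.
move=> i j ij; rewrite /bidiagonal_mx; case: eqP; first lia.
by case: eqP => //; lia.
Qed.

Lemma banded_tr_bidiagonal (u rt : seqC) :
  banded 0 (infmx_tr (bidiagonal_mx u rt)).
Proof.
move=> i j ij; rewrite /infmx_tr /bidiagonal_mx; case: eqP; first lia.
by case: eqP => //; lia.
Qed.

Lemma banded_jacobi (c lam : nat -> R) : banded 1 (jacobi_mx c lam).
Proof.
move=> i j ij; rewrite /jacobi_mx; case: eqP; first lia.
by case: eqP => //; [lia|case: eqP => //; lia].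
Qed.

Lemma jacobi_mx_tr (c lam : nat -> R) :
  infmx_tr (jacobi_mx c lam) = jacobi_mx c lam.
Proof.
apply/funext => i; apply/funext => j; rewrite /infmx_tr /jacobi_mx.
case: eqP => [->|ne]; first by rewrite eqxx.
have /eqP/negbTE -> : i <> j by move=> e; apply: ne.
by case: eqP => // e1; case: eqP => //; lia.
Qed.

Lemma tridiagonal_sum (A : seqC) x i : (forall j, (j.+1 < i)%N -> A j = 0) ->
  \sum_(j < i.+2) A j * x j = A i * x i + A i.+1 * x i.+1 +
    (if i is k.+1 then A k * x k else 0).
Proof.
case: i => [|i] A0; first by rewrite !big_ord_recr big_ord0 /= addr0 add0r.
rewrite !big_ord_recr /= big1 ?add0r; last first.
  by move=> j _; rewrite A0 ?mul0r// !ltnS.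
by ring.
Qed.

Lemma jacobi_actE (c lam : nat -> R) x i :
  infmx_act (jacobi_mx c lam) x i = jacobi_b c i * x i + jacobi_a lam i * x i.+1 +
    (if i is j.+1 then jacobi_a lam j * x j else 0).
Proof.
have lt2 : (i + 1 < i.+2)%N by rewrite addn1.
rewrite (infmx_act_banded x (@banded_jacobi c lam) lt2) (tridiagonal_sum (A := jacobi_mx c lam i)).
  rewrite /jacobi_mx !eqxx ltn_eqF//; case: i {lt2} => [|i] //.
  by rewrite eqxx gtn_eqF// ltn_eqF// ltnW.
move=> j ji; rewrite -(@jacobi_mx_tr c lam) /infmx_tr banded_jacobi//.
by rewrite addn1.
Qed.

Lemma bidiagonal_actE (u rt : seqC) x i :
  infmx_act (bidiagonal_mx u rt) x i = u i * rt i * x i + rt i.+1 * x i.+1.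
Proof.
have lt2 : (i + 1 < i.+2)%N by rewrite addn1.
rewrite (infmx_act_banded x (@banded_bidiagonal u rt) lt2).
rewrite (tridiagonal_sum (A := bidiagonal_mx u rt i)); last first.
  by move=> j ji; apply: banded_tr_bidiagonal; rewrite addn0 ltnW.
rewrite /bidiagonal_mx !eqxx ltn_eqF//; case: i {lt2} => [|i]; first by rewrite addr0.
by rewrite gtn_eqF// ltn_eqF ?mul0r ?addr0// ltnW.
Qed.

Lemma tr_bidiagonal_actE (u rt : seqC) x i :
  infmx_act (infmx_tr (bidiagonal_mx u rt)) x i = u i * rt i * x i +
    (if i is j.+1 then rt i * x j else 0).
Proof.
have lt2 : (i + 0 < i.+2)%N by rewrite addn0 ltnW.
rewrite (infmx_act_banded x (@banded_tr_bidiagonal u rt) lt2).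
rewrite (tridiagonal_sum (A := infmx_tr (bidiagonal_mx u rt) i)); last first.
  by move=> j ji; apply: banded_bidiagonal; rewrite addn1.
rewrite [X in _ + X * _]banded_tr_bidiagonal ?addn0// mul0r addr0.
rewrite /infmx_tr /bidiagonal_mx eqxx; case: i {lt2} => [|i] //.
by rewrite ltn_eqF// eqxx.
Qed.

Lemma bidiagonal_l2_bounded (u rt : seqC) (K : R) :
  (forall i, normc (u i * rt i) <= K) -> (forall i, normc (rt i) <= K) ->
  l2_bounded (infmx_act (bidiagonal_mx u rt)) /\
  l2_bounded (infmx_act (infmx_tr (bidiagonal_mx u rt))).
Proof.
move=> uK rK; have K0 : 0 <= K by apply: le_trans (rK 0%N); exact: normc_ge0.
split; exists (K + K); rewrite ?addr_ge0// => x M xM; rewrite mulrDl.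
  have := l2_leD (l2_leM xM K0 uK)
    (@l2_leM _ _ (fun k => rt k.+1) _ _ (l2_le_shift xM) K0 (fun k => rK k.+1)).
  by congr l2_le; apply/funext => i; rewrite bidiagonal_actE.
have := l2_leD (l2_leM xM K0 uK) (l2_leM (l2_le_pre xM) K0 rK).
congr l2_le; apply/funext => i; rewrite tr_bidiagonal_actE.
by case: i => //=; rewrite mulr0.
Qed.

(** Column [j] is the image of the [j]-th unit sequence, so its norm is at most the operator bound.
    The band of the transpose makes columns finitely supported, hence in l2, and the unit sequence
    serves as its own approximation in the closure. *)
Lemma infmx_bounded_entries m (A : infmx R) : banded m A -> banded m (infmx_tr A) ->
  bounded_operator (matrix_operator A) ->
  exists2 M : R, 0 <= M & forall i j, normc (A i j) <= M.
Proof.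
move=> bA bAT [_ [M hM]]; exists `|M| => // i j.
pose e : seqC := fun k => (k == j)%:R.
have Ae : infmx_act A e = A^~ j.
  apply/funext => k.
  have kn : (k + m < (k + m + j).+1)%N by rewrite ltnS leq_addr.
  have jn : (j < (k + m + j).+1)%N by rewrite ltnS leq_addl.
  rewrite (infmx_act_banded _ bA kn) (bigD1 (Ordinal jn)) //= /e eqxx mulr1.
  rewrite big1 ?addr0// => l /eqP lj; rewrite (_ : (_ == _) = false) ?mulr0//.
  by apply/eqP => lj'; apply: lj; exact: val_inj.
have e1 : l2_le e 1.
  split=> // n; case: (ltnP j n) => jn.
    rewrite (bigD1 (Ordinal jn)) //= /e eqxx normc1 expr1n big1 ?addr0 ?expr1n//.
    move=> l /eqP lj; rewrite (_ : (_ == _) = false) ?normc0 ?expr0n//.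
    by apply/eqP => lj'; apply: lj; exact: val_inj.
  rewrite big1 ?expr1n// => l _; rewrite /e ltn_eqF ?normc0 ?expr0n//.
  exact: leq_trans (ltn_ord l) jn.
have fe : finitely_supported e by exists j.+1 => n; rewrite /e => /gtn_eqF ->.
have fA : finitely_supported (A^~ j).
  by exists (j + m).+1 => n jn; exact: bAT.
have n0 (y : seqC) (eps : R) : 0 < eps -> (l2norm (y \- y)%R < eps%:E)%E.
  move=> e0; apply: (@le_lt_trans _ _ 0%:E); last by rewrite lte_fin.
  apply/l2norm_leP => //; split=> // n; rewrite big1 ?expr0n// => k _.
  by rewrite /= subrr normc0 expr0n.
have /hM h : matrix_operator A e (A^~ j).
  split; [exact: finitely_supported_l2|exact: finitely_supported_l2|].
  by move=> eps eps0; exists e; rewrite Ae; split=> //; exact: n0.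
apply: (@l2_le_coord _ (A^~ j)); apply/l2norm_leP => //; apply: (le_trans h).
apply: (@le_trans _ _ (`|M|%:E * l2norm e)%E).
  by rewrite lee_wpmul2r ?lee_fin ?ler_norm//; exact: Lnorm_ge0.
rewrite -[leRHS]mule1 lee_wpmul2l ?lee_fin//; exact/l2norm_leP.
Qed.

Lemma l2inner_e0 x : l2inner x e0 = x 0%N.
Proof.
rewrite /l2inner; apply: (@lim_near_cst C^o); first exact: norm_hausdorff.
exists 1%N => // n /= n1; case: n n1 => // n _.
rewrite big_ord_recl big1 ?addr0 /e0 /= ?conjC1 ?mulr1// => k _.
by rewrite conjC0 mulr0.
Qed.

(** The resolvent is a left inverse, so any l2 solution of [(A - kappa) x = e0] is its value at
    [e0], whichever resolvent [xget] picks. *)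
Lemma m_functionE (A : infmx R) (kappa : C) x :
  seq_linear (infmx_act A) -> l2_bounded (infmx_act A) ->
  resolvent_set (matrix_operator A) kappa ->
  l2 x -> infmx_act A x \- kappa \*o x = e0 ->
  m_function (matrix_operator A) kappa = x 0%N.
Proof.
move=> linA bA resA xl2 xE; rewrite /m_function l2inner_e0.
have : is_resolvent (matrix_operator A) kappa (resolvent (matrix_operator A) kappa).
  by case: resA => B hB; apply: (@xgetPex _ _ [set B | is_resolvent _ _ B]); exists B.
by move=> /(is_resolventP _ _ linA bA)[_ _ h]; rewrite -xE h.
Qed.

End TridiagonalMatrices.

Theorem theorem5p10 (R : realType)
    (L : {scalar {poly R[i]}}) (hL : positive_definite L) (hL1 : L 1 = 1)
    (P : nat -> {poly R[i]}) (hP : monic_orthogonal L P)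
    (c lam : nat -> R) (hrec : three_term_recurrence P c lam)
    (hJ : bounded_operator (matrix_operator (jacobi_mx c lam)))
    (kappa : R[i]) (Lg : {scalar {poly R[i]}})
    (hLg : geronimus_functional L kappa Lg)
    (hhalf : (0 < complex.Im kappa /\ complex.Im (Lg 1) <= 0) \/
             (complex.Im kappa < 0 /\ 0 <= complex.Im (Lg 1)))
    (hs0 : Lg 1 <> 0)
    (hsm : Lg 1 <> m_function (matrix_operator (jacobi_mx c lam)) kappa)
    (u0 : R[i]) (hu0 : u0 ^+ 2 = (Lg 1)^-1)
    (rt : nat -> R[i])
    (hrt : forall j, rt j ^+ 2 = geronimus_t L P kappa (Lg 1) j) :
  spectrum (matrix_operator (geronimus_mx L P lam kappa (Lg 1) u0 rt)) =
  spectrum (matrix_operator (jacobi_mx c lam)) `|` [set kappa].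
Proof.
set s0 := Lg 1 in hhalf hs0 hsm hu0 hrt *.
set J := jacobi_mx c lam in hJ hsm *.
set t := geronimus_t L P kappa s0 in hrt.
set G := geronimus_mx L P lam kappa s0 u0 rt.
set u := geronimus_u L P lam kappa s0 u0.
pose U := bidiagonal_mx u rt; pose F := infmx_act U; pose H := infmx_act (infmx_tr U).
have k_neq0 : complex.Im kappa != 0.
  by case: hhalf => -[h _]; rewrite ?(gt_eqF h) ?(lt_eqF h).
have t1 : t 1%N = (c 1%N)%:C - kappa - s0^-1 := geronimus_t1 hL1 hrec kappa s0.
have tE j : t j.+2 = (c j.+2)%:C - kappa - (lam j.+2)%:C / t j.+1.
  by have [] := geronimus_t_spec hL hL1 hP hrec hhalf j.
have t_ge j : `|complex.Im kappa| <= normc (t j.+1).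
  exact: (geronimus_t_ge hL hL1 hP hrec hhalf j).
have t_neq0 j : t j.+1 != 0.
  apply/eqP => tj0; have := t_ge j; rewrite tj0 normc0 leNgt normr_gt0.
  by rewrite k_neq0.
have a2 j : jacobi_a lam j ^+ 2 = (lam j.+2)%:C.
  rewrite /jacobi_a -rmorphXn /= sqr_sqrtr// ltW//.
  exact: (recurrence_lam_gt0 hL hP hrec).
have [M M0 JM] : exists2 M : R, 0 <= M & forall i j, normc (J i j) <= M.
  apply: (infmx_bounded_entries (@banded_jacobi _ c lam)) => //.
  by rewrite jacobi_mx_tr; exact: banded_jacobi.
have aM j : normc (jacobi_a lam j) <= M.
  by have := JM j j.+1; rewrite /J /jacobi_mx ltn_eqF// eqxx.
have bM j : normc (jacobi_b c j) <= M.
  by have := JM j j; rewrite /J /jacobi_mx eqxx.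
(* Since [rt j ^ 2 = t j] and [u j * rt j] squares to [lam j.+1 / t j]
   for [j >= 1], the lower bound on [t] bounds [U]. *)
have [bF bH] : l2_bounded F /\ l2_bounded H.
  have d0 : 0 < `|complex.Im kappa| by rewrite normr_gt0.
  have [d [dE d_gt0]] : exists d, `|complex.Im kappa| = d /\ 0 < d by eexists.
  have [k [kE k_ge0]] : exists k, normc kappa = k /\ 0 <= k.
    by exists (normc kappa); rewrite normc_ge0.
  have [s [sE s_ge0]] : exists s, normc s0^-1 = s /\ 0 <= s.
    by exists (normc s0^-1); rewrite normc_ge0.
  have lamt j : normc ((lam j.+2)%:C / t j.+1) <= M ^+ 2 / d.
    rewrite -a2 normcM normcV expr2 normcM -expr2 ler_pM ?sqr_ge0 ?invr_ge0 ?normc_ge0//.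
      by rewrite ler_sqr ?nnegrE ?normc_ge0.
    have td : d <= normc (t j.+1) by rewrite -dE.
    by rewrite lef_pV2 ?posrE// (lt_le_trans d_gt0).
  have Md0 : 0 <= M ^+ 2 / d by rewrite divr_ge0 ?sqr_ge0 ?ltW.
  have [e [eE {}Md0]] : exists e, M ^+ 2 / d = e /\ 0 <= e by eexists.
  rewrite eE in lamt.
  have cb z : normc z <= M -> normc (z - kappa) <= M + k.
    by move=> zM; apply: le_trans (normcB _ _) _; rewrite kE lerD2r.
  (* [T] bounds the squared entries of [U]: [1] is for [t_0], [s] for [u_0^2 t_0], [e] for
     [u_j^2 t_j], and the last two for [t_1] and the later [t_j]. Having [T >= 1] lets the same [T]
     bound the entries themselves. *)
  have [T [T1 sT eT MksT MkeT]] : exists T,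
      [/\ 1 <= T, s <= T, e <= T, M + k + s <= T & M + k + e <= T].
    by clear - M0 k_ge0 s_ge0 Md0; exists (1 + M + k + s + e); split; lra.
  have sqT (z : R[i]) : normc (z ^+ 2) <= T -> normc z <= T.
    rewrite expr2 normcM; move: (normc z) (normc_ge0 z) => n n0 h.
    have [n1|n1] := leP n 1; first exact: le_trans T1.
    by apply: le_trans h; rewrite ler_peMl// ltW.
  apply: (@bidiagonal_l2_bounded _ u rt T) => i; apply: sqT.
    rewrite exprMn hrt; case: i => [|i].
      by rewrite /= hu0 mulr1 sE.
    rewrite /= exprMn a2 -/(t i.+1) exprVn expr2 invfM mulrA (mulfVK (t_neq0 i)).
    exact: le_trans (lamt i) _.
  rewrite hrt; case: i => [|[|i]]; first by rewrite /t /= normc1.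
    rewrite t1; apply: le_trans (normcB _ _) _; rewrite sE.
    exact: le_trans (lerD (cb _ (bM 0%N)) (lexx _)) _.
  rewrite tE; apply: le_trans (normcB _ _) _.
  exact: le_trans (lerD (cb _ (bM i.+1)) (lamt i)) _.
have bU := @banded_bidiagonal _ u rt; have bUT := @banded_tr_bidiagonal _ u rt.
have linF : seq_linear F by exact: infmx_act_linear bU.
have linH : seq_linear H by exact: infmx_act_linear bUT.
(* Off the diagonal, [u_j t_j = a_(j-1)]. On it, the entry is [u_i^2 t_i + t_(i+1) + kappa], and the
   recurrence for [t_(i+1)] cancels [lam_(i+1) / t_i], or [1 / s0] in row [0], leaving [c_(i+1)]. *)
have JE x : infmx_act J x = F (H x) \+ kappa \*o x.
  apply/funext => i; rewrite /= /F /H bidiagonal_actE !tr_bidiagonal_actE jacobi_actE.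
  have diag j : u j.+1 * rt j.+1 ^+ 2 = jacobi_a lam j.
    by rewrite hrt /u /= -/(t j.+1) (mulfVK (t_neq0 j)).
  have diag2 j : u j.+1 ^+ 2 * rt j.+1 ^+ 2 = (lam j.+2)%:C / t j.+1.
    by rewrite hrt /u /= -/(t j.+1) exprMn a2 exprVn expr2 invfM mulrA (mulfVK (t_neq0 j)).
  have -> : u i * rt i * (u i * rt i * x i + (if i is j.+1 then rt i * x j else 0)) +
      rt i.+1 * (u i.+1 * rt i.+1 * x i.+1 + rt i.+1 * x i) + kappa * x i =
      (u i ^+ 2 * rt i ^+ 2 + rt i.+1 ^+ 2 + kappa) * x i +
      (u i.+1 * rt i.+1 ^+ 2) * x i.+1 +
      (if i is j.+1 then (u i * rt i ^+ 2) * x j else 0).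
    by case: i => [|i]; ring.
  rewrite diag; case: i => [|i].
    by rewrite !hrt t1 /u /= hu0 /jacobi_b; ring.
  by rewrite diag diag2 hrt tE /jacobi_b; ring.
have GE x : infmx_act G x = H (F x) \+ kappa \*o x.
  rewrite /G /geronimus_mx (infmx_act_add_scalar _ _ (banded_mul bUT bU)).
  by rewrite (infmx_act_mul _ bUT bU).
have linJ : seq_linear (infmx_act J) by exact: infmx_act_linear (@banded_jacobi _ c lam).
have linG : seq_linear (infmx_act G).
  by move=> z x y; rewrite !GE linF linH; apply/funext => k /=; ring.
have bndk : l2_bounded (fun x => kappa \*o x) := l2_bounded_scale kappa (@l2_bounded_id R).
(* Both actions inherit boundedness from [U] and [U^T]; this is what allows the graph operators to
   be replaced by maps in [resJ] and [resG]. *)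
have bJ : l2_bounded (infmx_act J).
  rewrite (_ : infmx_act J = fun x => (F \o H) x \+ kappa \*o x); last exact/funext.
  by apply: l2_bounded_add => //; exact: l2_bounded_comp.
have bG : l2_bounded (infmx_act G).
  rewrite (_ : infmx_act G = fun x => (H \o F) x \+ kappa \*o x); last exact/funext.
  by apply: l2_bounded_add => //; exact: l2_bounded_comp.
have resJ z : resolvent_set (matrix_operator J) z <->
    exists B, seq_resolvent (fun x => F (H x) \+ kappa \*o x) z B.
  rewrite -(_ : infmx_act J = fun x => F (H x) \+ kappa \*o x); last exact/funext.
  by split=> -[B hB]; exists B; apply/is_resolventP.
have resG z : resolvent_set (matrix_operator G) z <->
    exists B, seq_resolvent (fun x => H (F x) \+ kappa \*o x) z B.
  rewrite -(_ : infmx_act G = fun x => H (F x) \+ kappa \*o x); last exact/funext.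
  by split=> -[B hB]; exists B; apply/is_resolventP.
have resJk : resolvent_set (matrix_operator J) kappa.
  have aM' i : `|Num.sqrt (lam i.+2)| <= M by rewrite -normc_real; exact: aM.
  have [B hB] := jacobi_resolvent_nonreal (b := fun i => c i.+1) linJ bJ aM'
    (jacobi_actE c lam) k_neq0.
  by exists B; apply/is_resolventP.
(* If [kappa] were regular for [J_G], then [U^T] would be onto, and
   [U^T x = e0] gives [(J - kappa) x = U e0 = u0 rt_0 e0] with
   [x_0 = (u0 rt_0)^-1], whence [m (J; kappa) = (u0 rt_0)^-2 = s0]. *)
have resGk : ~ resolvent_set (matrix_operator G) kappa.
  move=> /resG[B [bB hB _]]; apply: hsm; set w := u0 * rt 0%N.
  have w2 : w ^+ 2 = s0^-1 by rewrite exprMn hu0 hrt mulr1.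
  have w0 : w != 0 by rewrite -sqrf_eq0 w2 invr_eq0; exact/eqP.
  have e0l2 : l2 (@e0 R).
    by apply: finitely_supported_l2; exists 1%N => -[].
  pose x := F (B e0).
  have Hx : H x = e0.
    apply/funext => k; have /(congr1 (fun f => f k)) /= := hB _ e0l2.
    by move=> /addIr.
  have xl2 : l2 x by apply: l2_bounded_l2 => //; exact: l2_bounded_l2 bB _.
  have x0 : w * x 0%N = 1.
    have /(congr1 (fun f => f 0%N)) := Hx.
    by rewrite /H tr_bidiagonal_actE addr0 /u /= -/w /e0 /=.
  rewrite (@m_functionE _ _ _ (w^-1 \*o x) linJ bJ resJk); last 2 first.
  - exact: l2Z.
  - rewrite (seq_linearZ linJ) JE Hx; apply/funext => k /=.
    rewrite /F bidiagonal_actE; case: k => [|k] /=.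
      by rewrite /e0 /= -/w; field.
    by rewrite /e0 /=; ring.
  by rewrite /= -[LHS]invrK -w2 -[x 0%N](mulKf w0) x0 mulr1 -invfM -expr2.
apply/seteqP; split=> z /=.
  move=> /= zG; have [->|zk] := eqVneq z kappa; [by right|left].
  move=> /resJ[B hB]; apply: zG; apply/resG; eexists.
  exact: (seq_resolvent_swap linF linH bF bH zk hB).
case=> [zJ /resG[B hB]|->//]; apply: zJ.
have [->//|zk] := eqVneq z kappa; apply/resJ; eexists.
exact: (seq_resolvent_swap linH linF bH bF zk hB).
Qed.
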